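(* There exist a symmetric, nonnegative $w(\cdot,\cdot,\cdot,\cdot,\cdot)$ and bounded functions $x_t$ satisfying $$\dot{x}_t(\alpha) = \int_{0}^{1} w(t,\alpha,\beta,x_t(\alpha),x_t(\beta))\,(x_t(\beta)-x_t(\alpha))\,d\beta$$ with this $w$, such that the set of $\alpha\in[0,1]$ for which $x_t(\alpha)$ does not converge as $t\to\infty$ has positive Lebesgue measure.
   Context: The weight function $w:[0,\infty)\times[0,1]\times[0,1]\times\mathbb{R}\times\mathbb{R}\to[0,\infty)$ is required to be jointly measurable in all its variables and bounded: $w\le W$ for some constant $W<\infty$. Symmetric means $w(t,\alpha,\beta,x_t(\alpha),x_t(\beta))=w(t,\beta,\alpha,x_t(\beta),x_t(\alpha))$ for all $t,\alpha,\beta$. That the functions $x_t$ satisfy the equation means: $(t,\alpha)\mapsto x_t(\alpha)$ maps $[0,\infty)\times[0,1]$ to $\mathbb{R}$; $x_t(\cdot)$ is measurable for each $t$; and for each $\alpha\in[0,1]$, $t\mapsto x_t(\alpha)$ is absolutely continuous (on bounded intervals) and the equation holds for almost all $t$. Bounded means $\sup_{t\ge0,\alpha\in[0,1]}|x_t(\alpha)|<\infty$ (the initial values are not required to lie in $[0,1]$). *)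

(* Defs.v *)
From HB Require Import structures.
From mathcomp Require Import all_boot all_order all_algebra.
From mathcomp Require Import all_classical all_reals all_analysis.

Set Implicit Arguments.
Unset Strict Implicit.
Unset Printing Implicit Defensive.

Import Order.TTheory GRing.Theory Num.Theory.
Import numFieldNormedType.Exports.

Local Open Scope classical_set_scope.
Local Open Scope ring_scope.

(* Functions whose mathematical domain is [0, +oo[ x [0, 1] (for x) or
   [0, +oo[ x [0, 1] x [0, 1] x R x R (for w) are total functions here;
   every condition below only constrains their values on that domain. *)

Definition weight_dom (R : realType) : set (R * R * R * R * R) :=
  [set p | let: (t, a, b, _, _) := p in
           [/\ 0 <= t, 0 <= a <= 1 & 0 <= b <= 1]].

Definition weight (R : realType) (w : R * R * R * R * R -> R) : Prop :=
  [/\ measurable_fun (@weight_dom R) w,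
      forall p, weight_dom p -> 0 <= w p &
      exists W : R, forall p, weight_dom p -> w p <= W].

(* Symmetry is only required along the solution x. *)
Definition symmetric_along (R : realType) (w : R * R * R * R * R -> R)
    (x : R -> R -> R) : Prop :=
  forall t a b : R, 0 <= t -> 0 <= a <= 1 -> 0 <= b <= 1 ->
    w (t, a, b, x t a, x t b) = w (t, b, a, x t b, x t a).

Definition abs_continuous (R : realType) (a b : R) (f : R -> R) : Prop :=
  forall e : R, 0 < e -> exists2 d : R, 0 < d &
    forall (n : nat) (u v : 'I_n -> R),
      (forall i, [/\ a <= u i, u i < v i & v i <= b]) ->
      trivIset [set: 'I_n] (fun i => `]u i, v i[%classic) ->
      \sum_(i < n) (v i - u i) < d ->
      \sum_(i < n) `|f (v i) - f (u i)| < e.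

(* The integrand is bounded and Borel on [0, 1] for the w and x_t considered
   here, so the real-valued integral carries no junk value. *)
Definition rhs (R : realType) (w : R * R * R * R * R -> R) (x : R -> R -> R)
    (t a : R) : R :=
  \int[@lebesgue_measure R]_(b in `[0, 1])
    (w (t, a, b, x t a, x t b) * (x t b - x t a)).

Definition solution (R : realType) (w : R * R * R * R * R -> R)
    (x : R -> R -> R) : Prop :=
  (forall t : R, 0 <= t -> measurable_fun (`[0, 1]%classic : set R) (x t)) /\
  (forall a : R, 0 <= a <= 1 ->
     (forall T : R, 0 <= T -> abs_continuous 0 T (x ^~ a)) /\
     {ae @lebesgue_measure R, forall t : R, 0 <= t ->
        is_derive t 1 (x ^~ a) (rhs w x t a)}).

Definition bounded_trajectories (R : realType) (x : R -> R -> R) : Prop :=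
  exists M : R, forall t a : R, 0 <= t -> 0 <= a <= 1 -> `|x t a| <= M.

Definition nonconvergence_set (R : realType) (x : R -> R -> R) : set R :=
  [set a | 0 <= a <= 1 /\ ~ (exists l : R, x t a @[t --> +oo] --> l)].

(* Main.v *)
(** Let every agent rotate: x_t(a) = r(t) cos(th) with th = 2 pi a + phi(t).
    A weight of the form k(th_a + th_b) is symmetric, and since
    cos(s - th) - cos th = cos th (cos s - 1) + sin th sin s, the right-hand
    side it produces is again a combination of cos th (a contraction of r) and
    sin th (a rotation). If k is the indicator of an arc of angular width e just
    below 0, the contraction is of order e^3 but the rotation of order e^2.
    With phi = ln (1 + t), e = (1 + t)^(-1/2) and r = exp (2 e), which satisfy
    phi' = e^2 and r' = - e^3 r, the radius r decreases to 1 while the phase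
    tends to infinity, so no trajectory converges. The missing part of the
    contraction is supplied by adding a constant to the weight. *)

Require Import Defs.
From mathcomp Require Import all_boot all_order all_algebra.
From mathcomp Require Import all_classical all_reals all_analysis.
From mathcomp Require Import measurable_realfun ring lra.

Import Order.TTheory GRing.Theory Num.Theory.
Import numFieldNormedType.Exports.

Local Open Scope classical_set_scope.
Local Open Scope ring_scope.

(** * Trigonometric inequalities and periodicity *)

Lemma is_derive1_continuous {R : realType} {f : R -> R} {x d : R} :
  is_derive x 1 f d -> {for x, continuous f}.
Proof.
move=> fx; apply/differentiable_continuous/derivable1_diffP.
exact: ex_derive.
Qed.

(** The difference [sin z - z * cos z] vanishes at 0 and has derivative [z * sin z], nonnegative up
    to [pi]. *)
Lemma mulr_cos_le_sin (R : realType) (y : R) : 0 <= y <= pi -> y * cos y <= sin y.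
Proof.
move=> /andP[y0 ypi].
pose f (z : R) := sin z - z * cos z.
have df (z : R) : is_derive z 1 f (z * sin z).
  rewrite /f; apply: is_derive_eq.
  rewrite /GRing.scale /=; ring.
have [|z zy] := MVT_segment y0 (fun z _ => df z).
  by apply: continuous_subspaceT => z; exact: (is_derive1_continuous (df z)).
rewrite /f sin0 mul0r !subr0 => fy; rewrite -subr_ge0 fy mulr_ge0//.
move: zy; rewrite in_itv/= => /andP[z0 zy].
by rewrite mulr_ge0// sin_ge0_pi// z0 (le_trans zy).
Qed.

(** Square [y * cos 1 <= y * cos y <= sin y] and use [sin y ^+ 2 = (1 - cos y) * (1 + cos y) <= 2 *
    (1 - cos y)]. This quadratic bound keeps [transport] bounded as the arc shrinks. *)
Lemma onem_cos_ge (R : realType) (y : R) : 0 <= y <= 1 ->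
  y ^+ 2 * (cos 1 ^+ 2 / 2) <= 1 - cos y.
Proof.
move=> /andP[y0 y1].
have pi2 := @pi_ge2 R.
have c1 : cos 1 <= cos y.
  by rewrite leNgt ltr_cos ?in_itv/= -?leNgt//; apply/andP; split; lra.
have c0 := @cos1_gt0 R.
have sy : y * cos y <= sin y by apply: mulr_cos_le_sin; lra.
have h : (y * cos 1) ^+ 2 <= sin y ^+ 2.
  rewrite ler_sqr ?nnegrE.
  - by apply: le_trans sy; rewrite ler_wpM2l.
  - by rewrite mulr_ge0// ltW.
  - by apply: le_trans sy; rewrite mulr_ge0// (le_trans (ltW c0)).
have := cos2Dsin2 y; have := cos_le1 y; nra.
Qed.

Lemma onem_cos_gt0 (R : realType) (y : R) : 0 < y <= 1 -> 0 < 1 - cos y.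
Proof.
move=> /andP[y0 y1]; apply: lt_le_trans (onem_cos_ge _ _ _); last by rewrite ltW.
by rewrite mulr_gt0 ?exprn_gt0// divr_gt0 ?exprn_gt0 ?cos1_gt0.
Qed.

(** The multiple is an integer because it will come from a floor, which may be negative. *)
Lemma sinD2piz (R : realType) (y : R) (n : int) : sin (y + 2 * pi * n%:~R) = sin y.
Proof.
have E (m : nat) (z : R) : sin (z + 2 * pi * m%:R) = sin z.
  rewrite (_ : 2 * pi * m%:R = (pi *+ 2) *+ m); last by rewrite -[RHS]mulr_natr -(mulr_natr pi 2); ring.
  exact: (periodicn (@sinD2pi R)).
case: n => n; first exact: E.
by rewrite NegzE -(E n.+1); congr sin; rewrite mulrNz; ring.
Qed.

Lemma cosD2pin (R : realType) (y : R) (n : nat) : cos (y + 2 * pi * n%:R) = cos y.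
Proof.
rewrite (_ : 2 * pi * n%:R = (pi *+ 2) *+ n); last by rewrite -[RHS]mulr_natr -(mulr_natr pi 2); ring.
exact: (periodicn (@cosD2pi R)).
Qed.

(** * Piecewise integration over half-open intervals *)

(** Half-open pieces are disjoint and match the jumps of the floor function; integrability is
    carried along because additivity of the real-valued integral needs it. *)
Definition integral_co {R : realType} (f : R -> R) (a b v : R) : Prop :=
  (@lebesgue_measure R).-integrable `[a, b[ (EFin \o f) /\
  \int[@lebesgue_measure R]_(x in `[a, b[) f x = v.

Lemma integrable_setU d (T : measurableType d) (R : realType)
    (mu : {measure set T -> \bar R}) (A B : set T) (f : T -> \bar R) :
  measurable A -> measurable B -> [disjoint A & B] ->
  mu.-integrable A f -> mu.-integrable B f -> mu.-integrable (A `|` B) f.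
Proof.
move=> mA mB AB /integrableP[mAf iA] /integrableP[mBf iB].
have mf : measurable_fun (A `|` B) f by apply/measurable_funU.
apply/integrableP; split=> //.
rewrite ge0_integral_setU//; first exact: lte_add_pinfty.
exact: measurableT_comp.
Qed.

Lemma integral_co_cat (R : realType) (f : R -> R) (a b c u v : R) : a <= b <= c ->
  integral_co f a b u -> integral_co f b c v -> integral_co f a c (u + v).
Proof.
move=> /andP[ab bc] [iu <-] [iv <-].
have E : `[a, c[%classic = `[a, b[ `|` `[b, c[ :> set R.
  by apply: itv_bndbnd_setU; rewrite bnd_simp.
have D : [disjoint `[a, b[%classic & `[b, c[%classic : set R].
  apply/disj_setPRL => x /=; rewrite !in_itv/= => /andP[bx _].
  by apply/negP; rewrite negb_and -!leNgt bx orbT.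
have i : (@lebesgue_measure R).-integrable (`[a, b[ `|` `[b, c[) (EFin \o f).
  exact: integrable_setU.
by split; rewrite E// Rintegral_setU.
Qed.

(** Agreement of [f] and [g] is asked only on the half-open piece, so [f] may jump at [b]; [a = b]
    is allowed, so degenerate pieces need no separate case. *)
Lemma integral_co_FTC (R : realType) (f g F : R -> R) (a b : R) : a <= b ->
  continuous g -> (forall x : R, is_derive x 1 F (g x)) ->
  (forall x, a <= x < b -> f x = g x) ->
  integral_co f a b (F b - F a).
Proof.
move=> ab cg dF fg.
have ig : (@lebesgue_measure R).-integrable `[a, b] (EFin \o g).
  apply: continuous_compact_integrable; first exact: segment_compact.
  exact: continuous_subspaceT.
have igo : (@lebesgue_measure R).-integrable `[a, b[ (EFin \o g).
  by apply: integrableS ig => //; apply: subset_itvl; rewrite bnd_simp.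
have fgE : {in `[a, b[%classic, f =1 g}.
  by move=> x /set_mem /=; rewrite in_itv/=; exact: fg.
split.
  apply: eq_integrable igo => // x xab /=.
  by rewrite fgE.
transitivity (\int[@lebesgue_measure R]_(x in `[a, b[) g x).
  by apply: eq_Rintegral => x; exact: fgE.
rewrite Rintegral_itv_bndo_bndc//.
move: ab; rewrite le_eqVlt => /predU1P[<-|ab].
  by rewrite set_itv1 Rintegral_set1 subrr.
have cF : continuous F by move=> x; exact: (is_derive1_continuous (dF x)).
rewrite /Rintegral (@continuous_FTC2 _ g F)//.
- exact: continuous_subspaceT.
- split.
  + by move=> x _; exact: ex_derive.
  + exact/cvg_at_right_filter/cF.
  + exact/cvg_at_left_filter/cF.
- by move=> x _; rewrite derive1E; exact: derive_val.
Qed.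

(** * The arc weight and its integral *)

Definition frac_part {R : realType} (y : R) : R := y - (Num.floor y)%:~R.

Lemma frac_partE (R : realType) (y : R) (m : int) :
  m%:~R <= y < m%:~R + 1 -> frac_part y = y - m%:~R.
Proof.
move=> ym; rewrite /frac_part (@floor_def R y m)//.
by rewrite intrD.
Qed.

Lemma frac_part_itv (R : realType) (y : R) : 0 <= frac_part y < 1.
Proof.
rewrite /frac_part subr_ge0 floor_le/= ltrBlDl.
by have := floorD1_gt y; rewrite intrD addrC.
Qed.

(* One turn has length 1 for [s], so the arc of angle [e] below 0 is the set of
   [s] with fractional part at least [1 - e / (2 * pi)]. *)
Definition arc_weight {R : realType} (k d e s : R) : R :=
  if 1 <= frac_part s + e / (2 * pi) then k + d else d.

(** The argument of the weight is the sum of the two angles divided by [2 * pi], and it makes one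
    full turn as [b] crosses the unit interval. The constant [d] sees cosine with mean 0; the extra
    [k] acts on an arc of length [e / (2 * pi)], where [sin (th + e) - sin th - e * cos th] produces
    both terms. *)
Lemma integral_arc_weight (R : realType) (k d e p r a : R) : 0 < e <= 1 ->
  \int[@lebesgue_measure R]_(b in `[0, 1])
    (arc_weight k d e (a + b + p / pi) *
      (r * cos (2 * pi * b + p) - r * cos (2 * pi * a + p))) =
  - r * (k * (1 - cos e) / (2 * pi) * sin (2 * pi * a + p) +
         (k * (e - sin e) / (2 * pi) + d) * cos (2 * pi * a + p)).
Proof.
move=> /andP[e0 e1].
have pi2 := @pi_ge2 R.
have pi0 : pi != 0 :> R by rewrite gt_eqF// pi_gt0.
set th := 2 * pi * a + p.
pose f b := arc_weight k d e (a + b + p / pi) * (r * cos (2 * pi * b + p) - r * cos th).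
pose n := Num.floor (a + p / pi); pose q := frac_part (a + p / pi).
have /andP[q0 q1] : 0 <= q < 1 by exact: frac_part_itv.
have qE : q = a + p / pi - n%:~R by [].
pose h := e / (2 * pi).
have h0 : 0 < h by rewrite divr_gt0 ?mulr_gt0 ?pi_gt0.
have h1 : h < 1 by rewrite /h ltr_pdivrMr ?mulr_gt0 ?pi_gt0 //; lra.
pose g c b := c * (r * cos (2 * pi * b + p) - r * cos th).
pose G c b := c * r * (sin (2 * pi * b + p) / (2 * pi) - b * cos th).
have cg c : continuous (g c).
  move=> b; apply: (is_derive1_continuous
    (d := c * (r * (- sin (2 * pi * b + p) * (2 * pi))))).
  by rewrite /g; apply: is_derive_eq; rewrite /GRing.scale /=; ring.
have dG c (b : R) : is_derive b 1 (G c) (g c b).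
  rewrite /g /G; apply: is_derive_eq.
  rewrite /GRing.scale /=; move: (@pi R) pi0 => P P0; field; exact: P0.
have flow b : 0 <= b < 1 - q -> frac_part (a + b + p / pi) = q + b.
  by move=> /andP[b0 bq]; rewrite (@frac_partE _ _ n) ?qE; [ring|move: bq q0; rewrite qE; lra].
have fhigh b : 1 - q <= b < 1 -> frac_part (a + b + p / pi) = q + b - 1.
  by move=> /andP[b0 bq]; rewrite (@frac_partE _ _ (n + 1)) ?qE intrD;
    [ring|move: b0 q1; rewrite qE; lra].
(* At the two ends of the arc the angle of [b] is [- th] or [- (th + e)] modulo a full turn. *)
have sin1q : sin (2 * pi * (1 - q) + p) = - sin th.
  rewrite -sinN -[RHS](sinD2piz _ _ (1 + n)); congr sin.
  rewrite qE intrD /th; move: (@pi R) pi0 => P P0; field; exact: P0.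
have sin1hq : sin (2 * pi * (1 - h - q) + p) = - sin (th + e).
  rewrite -sinN -[RHS](sinD2piz _ _ (1 + n)); congr sin.
  rewrite qE intrD /th /h; move: (@pi R) pi0 => P P0; field; exact: P0.
have sin2hq : sin (2 * pi * (2 - h - q) + p) = - sin (th + e).
  rewrite -sinN -[RHS](sinD2piz _ _ (2 + n)); congr sin.
  rewrite qE intrD /th /h; move: (@pi R) pi0 => P P0; field; exact: P0.
have sin1p : sin (2 * pi * 1 + p) = sin p.
  by rewrite -[RHS](sinD2piz _ _ 1); congr sin; ring.
(* The value [x] stays open until the pieces have been concatenated, and is compared with the claim
   only then. *)
have whole x v : x = v -> integral_co f 0 1 x ->
    \int[@lebesgue_measure R]_(b in `[0, 1]) f b = v.
  by move=> <- [fi <-]; rewrite Rintegral_itv_bndo_bndc.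
(* The fractional part starts at [q] and wraps to 0 at [b = 1 - q]. If [q + h < 1] the arc is the
   single middle piece ending there; otherwise [b = 0] already lies in it, and it splits into an
   initial and a final piece. *)
have [qh|qh] := ltP (q + h) 1.
- apply: whole; last first.
    apply: (@integral_co_cat _ _ 0 (1 - q)); first by apply/andP; split; lra.
      apply: (@integral_co_cat _ _ 0 (1 - h - q)); first by apply/andP; split; lra.
        apply: (integral_co_FTC _ _ (g d) (G d)) => //; first lra.
        move=> b bI; rewrite /f /arc_weight flow; last lra.
        by rewrite leNgt ifN// negbK -/h; lra.
      apply: (integral_co_FTC _ _ (g (k + d)) (G (k + d))) => //; first lra.
      move=> b bI; rewrite /f /arc_weight flow; last lra.
      by rewrite ifT// -/h; lra.
    apply: (integral_co_FTC _ _ (g d) (G d)) => //; first lra.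
    move=> b bI; rewrite /f /arc_weight fhigh; last lra.
    by rewrite leNgt ifN// negbK -/h; lra.
  rewrite /G sin1q sin1hq sin1p (sinD th e) mulr0 add0r /h.
  by move: (@pi R) pi0 => P P0; field; exact: P0.
- apply: whole; last first.
    apply: (@integral_co_cat _ _ 0 (2 - h - q)); first by apply/andP; split; lra.
      apply: (@integral_co_cat _ _ 0 (1 - q)); first by apply/andP; split; lra.
        apply: (integral_co_FTC _ _ (g (k + d)) (G (k + d))) => //; first lra.
        move=> b bI; rewrite /f /arc_weight flow; last lra.
        by rewrite ifT// -/h; lra.
      apply: (integral_co_FTC _ _ (g d) (G d)) => //; first lra.
      move=> b bI; rewrite /f /arc_weight fhigh; last lra.
      by rewrite leNgt ifN// negbK -/h; lra.
    apply: (integral_co_FTC _ _ (g (k + d)) (G (k + d))) => //; first lra.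
    move=> b bI; rewrite /f /arc_weight fhigh; last lra.
    by rewrite ifT// -/h; lra.
  rewrite /G sin1q sin2hq sin1p (sinD th e) mulr0 add0r /h.
  by move: (@pi R) pi0 => P P0; field; exact: P0.
Qed.

(** * The rotating solution and its equation *)

(** The exponential form of [(1 + t) ^ (-1/2)] is positive for every real [t], so the radius exceeds
    1 without a condition on [t]. *)
Definition width {R : realType} (t : R) : R := expR (- ln (1 + t) / 2).

(* [transport] and [damping] are the coefficients for which the sine and cosine
   parts of [integral_arc_weight] are [e ^+ 2] and [e ^+ 3]. *)
Definition transport {R : realType} (e : R) : R := 2 * pi * e ^+ 2 / (1 - cos e).

Definition damping {R : realType} (e : R) : R :=
  e ^+ 2 * (sin e - e * cos e) / (1 - cos e).

Definition rotation {R : realType} (t a : R) : R :=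
  expR (2 * width t) * cos (2 * pi * a + ln (1 + t)).

Definition rotation_speed {R : realType} (t a : R) : R :=
  - expR (2 * width t) *
  (width t ^+ 2 * sin (2 * pi * a + ln (1 + t)) +
   width t ^+ 3 * cos (2 * pi * a + ln (1 + t))).

Definition rotation_weight {R : realType} (p : R * R * R * R * R) : R :=
  let: (t, a, b, _, _) := p in
  arc_weight (transport (width t)) (damping (width t)) (width t)
    (a + b + ln (1 + t) / pi).

Lemma width_itv (R : realType) (t : R) : 0 <= t -> 0 < width t <= 1.
Proof.
move=> t0; rewrite /width expR_gt0 /= -[leRHS]expR0 ler_expR.
have : 0 <= ln (1 + t) by rewrite ln_ge0// lerDl.
lra.
Qed.

Lemma width_sqr (R : realType) (t : R) : 0 <= t -> width t ^+ 2 = (1 + t)^-1.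
Proof.
move=> t0; rewrite /width -expRM_natl.
by rewrite mulrC divfK// expRN lnK// posrE; lra.
Qed.

(** A bound uniform in [e] is essential, since [width t] tends to 0. *)
Lemma transport_itv (R : realType) (e : R) : 0 < e <= 1 ->
  0 <= transport e <= 4 * pi / cos 1 ^+ 2.
Proof.
move=> e01; have /andP[e0 e1] := e01.
have v0 := onem_cos_gt0 _ _ e01.
have p0 : 0 < pi :> R by exact: pi_gt0.
have c0 : 0 < cos 1 ^+ 2 :> R by rewrite exprn_gt0// cos1_gt0.
apply/andP; split; first by rewrite divr_ge0 ?mulr_ge0 ?sqr_ge0 ?ltW.
rewrite /transport ler_pdivrMr// [leRHS]mulrAC ler_pdivlMr//.
have := onem_cos_ge _ e; rewrite (ltW e0) e1 => /(_ isT).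
nra.
Qed.

(** Nonnegativity is [e * cos e <= sin e]; [sin e <= e] gives the upper bound [e ^+ 3]. *)
Lemma damping_itv (R : realType) (e : R) : 0 < e <= 1 -> 0 <= damping e <= 1.
Proof.
move=> e01; have /andP[e0 e1] := e01.
have v0 := onem_cos_gt0 _ _ e01.
have pi2 := @pi_ge2 R.
have s : e * cos e <= sin e by apply: mulr_cos_le_sin; lra.
apply/andP; split.
  by rewrite divr_ge0 ?mulr_ge0 ?sqr_ge0 ?subr_ge0// ltW.
rewrite /damping ler_pdivrMr// mul1r.
have se : sin e <= e.
  have [|z _] := MVT_segment (ltW e0) (fun z _ => is_derive_sin z).
    exact/continuous_subspaceT/continuous_sin.
  by rewrite sin0 !subr0 => ->; rewrite ler_piMl ?(ltW e0)// cos_le1.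
have h1 : sin e - e * cos e <= e * (1 - cos e) by lra.
have h2 : e ^+ 2 * (sin e - e * cos e) <= e ^+ 2 * (e * (1 - cos e)).
  by rewrite ler_wpM2l// sqr_ge0.
apply: le_trans h2 _; rewrite mulrA -exprSr ler_piMl ?(ltW v0)//.
by rewrite exprn_ile1// ltW.
Qed.

Lemma is_derive_rotation (R : realType) (t a : R) : 0 <= t ->
  is_derive t 1 (rotation ^~ a) (rotation_speed t a).
Proof.
move=> t0.
have t1 : 0 < 1 + t by lra.
have dl : is_derive t 1 (fun t : R => ln (1 + t)) (width t ^+ 2).
  rewrite width_sqr//.
  have d1 : is_derive t 1 (fun t : R => 1 + t) 1.
    by apply: is_derive_eq; rewrite add0r mulr1.
  rewrite -[_^-1]mulr1.
  exact: (@is_derive1_comp _ (@ln R) (fun t => 1 + t) t _ _ (is_derive1_ln t1) d1).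
have dw : is_derive t 1 (@width R) (- width t ^+ 3 / 2).
  have dh : is_derive t 1 (fun t : R => - ln (1 + t) / 2) (- width t ^+ 2 / 2).
    by apply: is_derive_eq; rewrite /GRing.scale /= !mulr0 add0r mulrC.
  have := @is_derive1_comp _ expR (fun t => - ln (1 + t) / 2) t _ _ (is_derive_expR _) dh.
  rewrite -/(width t) (_ : width t * _ = - width t ^+ 3 / 2)//.
  by field.
rewrite /rotation /rotation_speed; apply: is_derive_eq.
by rewrite /GRing.scale /=; field.
Qed.

Lemma rhs_rotation (R : realType) (t a : R) : 0 <= t ->
  rhs rotation_weight rotation t a = rotation_speed t a.
Proof.
move=> t0; rewrite /rhs /rotation_weight /rotation /rotation_speed.
have w01 := width_itv _ _ t0.
rewrite integral_arc_weight// /transport /damping.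
have : 1 - cos (width t) != 0 by rewrite gt_eqF// onem_cos_gt0.
have : pi != 0 :> R by rewrite gt_eqF// pi_gt0.
move: (@pi R) => P P0 v0.
by congr (_ * (_ * _ + _ * _)); field; rewrite v0 P0.
Qed.

(** Two products of modulus at most 1, times a radius at most [expR 2]; this uniform bound yields
    the Lipschitz property and hence absolute continuity. *)
Lemma normr_derive_rotation (R : realType) (t a : R) : 0 <= t ->
  `|rotation_speed t a| <= 2 * expR 2.
Proof.
move=> t0; have /andP[w0 w1] := width_itv _ _ t0.
rewrite /rotation_speed normrM normrN (ger0_norm (expR_ge0 _)) mulrC ler_pM// ?expR_ge0//.
  rewrite (le_trans (ler_normD _ _))// -[leRHS]/(1 + 1) lerD// normrM mulr_ile1//.
  - by rewrite ger0_norm ?exprn_ge0 ?exprn_ile1// ltW.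
  - exact: sin_max.
  - by rewrite ger0_norm ?exprn_ge0 ?exprn_ile1// ltW.
  - exact: cos_max.
by rewrite ler_expR; lra.
Qed.

Lemma lipschitz_abs_continuous (R : realType) (f : R -> R) (a b K : R) :
  0 < K ->
  (forall u v, a <= u -> u <= v -> v <= b -> `|f v - f u| <= K * (v - u)) ->
  abs_continuous a b f.
Proof.
move=> K0 fK e e0; exists (e / K) => [|n u v uv _ sd]; first exact: divr_gt0.
apply: (@le_lt_trans _ _ (\sum_(i < n) K * (v i - u i))).
  by apply: ler_sum => i _; have [au /ltW uvi vb] := uv i; exact: fK.
by rewrite -mulr_sumr mulrC -ltr_pdivlMr.
Qed.

Lemma rotation_lipschitz (R : realType) (a u v : R) : 0 <= u -> u <= v ->
  `|rotation v a - rotation u a| <= 2 * expR 2 * (v - u).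
Proof.
move=> u0 uv.
have dr (z : R) (uz : u <= z) := is_derive_rotation _ z a (le_trans u0 uz).
have dr_oo z : z \in `]u, v[ -> is_derive z 1 (rotation ^~ a) (rotation_speed z a).
  by rewrite in_itv/= => /andP[/ltW uz _]; exact: dr.
have [|z zuv ->] := MVT_segment uv dr_oo.
  apply: continuous_in_subspaceT => z; rewrite inE/= in_itv/= => /andP[uz _].
  exact: (is_derive1_continuous (dr z uz)).
rewrite normrM (ger0_norm (_ : 0 <= v - u)) ?subr_ge0//.
rewrite ler_wpM2r ?subr_ge0// normr_derive_rotation//.
by move: zuv; rewrite in_itv/= => /andP[/(le_trans u0)].
Qed.

(** * Joint measurability of the weight *)

Lemma measurable_frac_part (R : realType) : measurable_fun setT (@frac_part R).
Proof.
apply: measurable_funB => //.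
apply: nondecreasing_measurable => // x y xy.
by rewrite ler_int le_floor.
Qed.

(** Inversion is the real power with exponent -1, also at 0, where both give 0. That case does
    occur: [1 - cos e] vanishes at multiples of [2 * pi]. *)
Lemma measurable_funV_ge0 d (T : measurableType d) (R : realType) (D : set T)
    (f : T -> R) : (forall x, 0 <= f x) ->
  measurable_fun D f -> measurable_fun D (fun x => (f x)^-1).
Proof.
move=> f0 mf; under eq_fun do rewrite -powR_inv1//.
exact: (measurableT_comp (@measurable_powR R (-1)) mf).
Qed.

Lemma measurable_cos (R : realType) : measurable_fun setT (@cos R).
Proof. by apply: continuous_measurable_fun; exact: continuous_cos. Qed.

Lemma measurable_sin (R : realType) : measurable_fun setT (@sin R).
Proof. by apply: continuous_measurable_fun; exact: continuous_sin. Qed.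

Lemma measurable_inv_onem_cos (R : realType) :
  measurable_fun setT (fun e : R => (1 - cos e)^-1).
Proof.
apply: measurable_funV_ge0 => [e|]; first by rewrite subr_ge0 cos_le1.
by apply: measurable_funB => //; exact: measurable_cos.
Qed.

Lemma measurable_transport (R : realType) : measurable_fun setT (@transport R).
Proof.
apply: measurable_funM; last exact: measurable_inv_onem_cos.
by apply: measurable_funM.
Qed.

Lemma measurable_damping (R : realType) : measurable_fun setT (@damping R).
Proof.
apply: measurable_funM; last exact: measurable_inv_onem_cos.
apply: measurable_funM => //; apply: measurable_funB; first exact: measurable_sin.
by apply: measurable_funM => //; exact: measurable_cos.
Qed.

Lemma measurable_width (R : realType) : measurable_fun setT (@width R).
Proof.
apply: measurableT_comp => //; apply: measurable_funM => //.
apply: measurableT_comp => //; apply: measurableT_comp => //.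
exact: measurable_funD.
Qed.

Lemma measurable_rotation_weight (R : realType) :
  measurable_fun setT (@rotation_weight R).
Proof.
pose t (p : R * R * R * R * R) := p.1.1.1.1.
pose s (p : R * R * R * R * R) := p.1.1.1.2 + p.1.1.2 + ln (1 + t p) / pi.
have mt : measurable_fun setT t.
  by do 3 apply: measurableT_comp => //.
have ms : measurable_fun setT s.
  apply: measurable_funD; [apply: measurable_funD|apply: measurable_funM] => //.
  - by do 3 apply: measurableT_comp => //.
  - by do 2 apply: measurableT_comp => //.
  - by apply: measurableT_comp => //; exact: measurable_funD.
have mw : measurable_fun setT (width \o t).
  by apply: measurableT_comp => //; exact: measurable_width.
have mk : measurable_fun setT (fun p => transport (width (t p))).
  by apply: (measurableT_comp (measurable_transport R)).
have md : measurable_fun setT (fun p => damping (width (t p))).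
  by apply: (measurableT_comp (measurable_damping R)).
rewrite (_ : rotation_weight = fun p =>
    arc_weight (transport (width (t p))) (damping (width (t p))) (width (t p)) (s p)).
  apply: measurable_fun_ifT => //; last exact: measurable_funD.
  apply: measurable_fun_ler => //; apply: measurable_funD.
    exact: (measurableT_comp (measurable_frac_part R)).
  exact: measurable_funM.
by apply/funext => -[[[[? ?] ?] ?] ?].
Qed.

(** * The required properties of weight and solution *)

Lemma weight_rotation_weight (R : realType) : weight (@rotation_weight R).
Proof.
split.
- exact: measurable_funTS (measurable_rotation_weight R).
- move=> [[[[t a] b] ? ?]] [t0 _ _] /=.
  have w01 := width_itv _ _ t0.
  have /andP[k0 _] := transport_itv _ _ w01.
  have /andP[d0 _] := damping_itv _ _ w01.
  by rewrite /arc_weight; case: ifP => _ //; rewrite addr_ge0.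
- exists (4 * pi / cos 1 ^+ 2 + 1) => -[[[[t a] b] ? ?]] [t0 _ _] /=.
  have w01 := width_itv _ _ t0.
  have /andP[k0 k1] := transport_itv _ _ w01.
  have /andP[d0 d1] := damping_itv _ _ w01.
  by rewrite /arc_weight; case: ifP => _; lra.
Qed.

Lemma solution_rotation (R : realType) : solution (@rotation_weight R) rotation.
Proof.
split=> [t t0|a a01].
  apply: measurable_funTS; apply: measurable_funM => //.
  apply: measurableT_comp; first exact: measurable_cos.
  by apply: measurable_funD.
split=> [T T0|].
  apply: (@lipschitz_abs_continuous _ _ _ _ (2 * expR 2)) => [|u v u0 uv _].
    by rewrite mulr_gt0 ?expR_gt0.
  exact: rotation_lipschitz.
(* The equation holds at every [t >= 0]; at 0 the two-sided derivative exists because the formula is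
   smooth for [t > -1]. *)
apply: aeW => t t0; rewrite rhs_rotation//.
exact: is_derive_rotation.
Qed.

Lemma bounded_rotation (R : realType) : bounded_trajectories (@rotation R).
Proof.
exists (expR 2) => t a t0 _; have /andP[_ w1] := width_itv _ _ t0.
rewrite normrM (ger0_norm (expR_ge0 _)) -[leRHS]mulr1.
by rewrite ler_pM ?expR_ge0 ?cos_max// ler_expR; lra.
Qed.

(** * Nonconvergence of every trajectory *)

Lemma rotation_frequently (R : realType) (a c A : R) :
  exists2 t, A < t & rotation t a = expR (2 * width t) * cos c.
Proof.
have pi2 := @pi_ge2 R.
(* The phase equals [c] after [N] turns when [ln (1 + t) = y]; this [N] makes [y > A], and
   [expR y - 1 >= y] passes the bound on to [t]. *)
pose N := Num.bound (`|A| + `|2 * pi * a - c|).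
have HN : `|A| + `|2 * pi * a - c| < N%:R by rewrite archi_boundP// addr_ge0.
pose y := c + 2 * pi * N%:R - 2 * pi * a.
have yA : A < y.
  have := ler_norm A; have := ler_norm (2 * pi * a - c).
  have : 0 <= N%:R :> R by [].
  rewrite /y; nra.
exists (expR y - 1); first by have := expR_ge1Dx y; lra.
rewrite /rotation addrCA subrr addr0 expRK /y.
by rewrite (_ : _ + (_ - _) = c + 2 * pi * N%:R) ?cosD2pin//; ring.
Qed.

(** At arbitrarily late times the phase is 0, with value at least 1, and [pi], with value at most
    -1; both cannot be within distance less than 1 of [l]. *)
Lemma rotation_not_cvg (R : realType) (a l : R) :
  ~ (rotation t a @[t --> +oo] --> l).
Proof.
move=> /cvgrPdist_lt/(_ 1 ltr01)[M [_ near1]].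
have r1 (t : R) : 1 <= expR (2 * width t).
  by rewrite -expR0 ler_expR mulr_ge0 ?expR_ge0.
have [t /near1 /=] := @rotation_frequently _ a 0 M.
rewrite ltr_norml => /andP[h _] tE; move: h; rewrite tE cos0 => h.
have [u /near1 /=] := @rotation_frequently _ a pi M.
rewrite ltr_norml => /andP[_ h'] uE; move: h'; rewrite uE cospi => h'.
have := r1 t; have := r1 u; lra.
Qed.

Lemma nonconvergence_set_rotation (R : realType) :
  nonconvergence_set (@rotation R) = `[0, 1]%classic.
Proof.
apply/seteqP; split => a /=; rewrite in_itv/=; first by case.
by move=> a01; split => // -[l]; exact: rotation_not_cvg.
Qed.

Theorem theorem1p2 (R : realType) :
  exists (w : R * R * R * R * R -> R) (x : R -> R -> R),
    [/\ weight w, symmetric_along w x, solution w x & bounded_trajectories x] /\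
    (measurable (nonconvergence_set x) /\
     (0 < @lebesgue_measure R (nonconvergence_set x))%E).
Proof.
exists rotation_weight, rotation; split.
  split; first exact: weight_rotation_weight.
  - by move=> t a b _ _ _; rewrite /rotation_weight (addrC a).
  - exact: solution_rotation.
  - exact: bounded_rotation.
rewrite nonconvergence_set_rotation; split; first exact: measurable_itv.
by rewrite lebesgue_measure_itv/= lte_fin ltr01 oppr0 adde0 lte_fin.
Qed.
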